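(* Let $A$ and $A'$ be two-dimensional algebras over $\mathbb F_2$, with structure matrices (also denoted $A$ and $A'$) with respect to linear bases $\{e,f\}$ of $A$ and $\{e',f'\}$ of $A'$, respectively. Then the algebras $A$ and $A'$ are isomorphic if and only if there is $X\in GL_2(\mathbb F_2)$ such that $$A'=\widetilde{X^{-1}}\,A\,X .$$
   Context: An algebra over the two-element field $\mathbb F_2$ is an $\mathbb F_2$-vector space with a bilinear multiplication, not assumed associative, commutative or unital. If $\{e,f\}$ is a linear base of a two-dimensional algebra and $e^2=a_1e+b_1f$, $f^2=a_2e+b_2f$, $ef=a_3e+b_3f$, $fe=a_4e+b_4f$ with $a_i,b_i\in\mathbb F_2$, then the structure matrix with respect to $\{e,f\}$ is the $4\times 2$ matrix $\begin{pmatrix}a_1&b_1\\ a_2&b_2\\ a_3&b_3\\ a_4&b_4\end{pmatrix}$. For $X=\begin{pmatrix}a&b\\ c&d\end{pmatrix}\in GL_2(\mathbb F_2)$, define $$\widetilde X=\begin{pmatrix}a&b&ab&ab\\ c&d&cd&cd\\ ac&bd&ad&bc\\ ac&bd&bc&ad\end{pmatrix}.$$ *)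

(* Defs.v *)
From mathcomp Require Import all_boot all_order all_algebra.

Set Implicit Arguments.
Unset Strict Implicit.
Unset Printing Implicit Defensive.

Import GRing.Theory.

Local Open Scope ring_scope.

(* An algebra over 'F_2 is a space V together with its product
   mul : {bilinear V -> V -> V}; no further axiom is assumed on mul. *)
Section Algebras.

Variables V V' : vectType 'F_2.
Variables (mul : {bilinear V -> V -> V}) (mul' : {bilinear V' -> V' -> V'}).

(* The rows are, in this order, the coordinates of e^2, f^2, ef and fe in the
   base (e, f); coord is meaningful only when (e, f) is free. *)
Definition structure_matrix (e f : V) : 'M['F_2]_(4, 2) :=
  \matrix_(i < 4, j < 2)
    coord [tuple e; f] j [:: mul e e; mul f f; mul e f; mul f e]`_i.

Definition algebra_isomorphic : Prop :=
  exists2 phi : {linear V -> V'}, bijective phi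
    & {morph phi : x y / mul x y >-> mul' x y}.

End Algebras.

Definition tilde (X : 'M['F_2]_2) : 'M['F_2]_4 :=
  let a := X 0 0 in let b := X 0 1 in
  let c := X 1 0 in let d := X 1 1 in
  \matrix_(i < 4, j < 4)
    (nth [::] [:: [:: a;     b;     a * b; a * b];
                  [:: c;     d;     c * d; c * d];
                  [:: a * c; b * d; a * d; b * c];
                  [:: a * c; b * d; b * c; a * d]] i)`_j.

(* Main.v *)
Require Import Defs.
From HB Require Import structures.
From mathcomp Require Import all_boot all_order all_algebra.

(** Identifying A' with A through an isomorphism turns the base (e', f') of A'
into some base (g, h) of A, and the structure matrix, which is written purely in
terms of the product, does not notice the transport. Conversely, if a base
(g, h) of A has the same structure matrix as (e', f'), then the linear map
sending g to e' and h to f' respects the products of base vectors, hence all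
products. So A and A' are isomorphic exactly when the structure matrix of
(e', f') is the structure matrix of some base of A
([algebra_isomorphicP]).

It remains to see how the structure matrix of A depends on the base. Let Y be
the matrix whose rows are the coordinates of g and h in (e, f). Expanding the
four products of g and h by bilinearity, and using a * a = a in the field with
two elements, the coefficients that appear are exactly the rows of [tilde Y]
([products_tilde]). Reading both sides in coordinates gives
S(g, h) Y = tilde(Y) S(e, f) ([structure_matrix_change]). As (g, h) runs
through the bases of A, Y runs through all the invertible matrices
([coord_mx_unit], [basis_of_coord_mx]), and X is the inverse of Y. *)

Set Implicit Arguments.
Unset Strict Implicit.
Unset Printing Implicit Defensive.

Import GRing.Theory.

Local Open Scope ring_scope.

(** * Linear maps and coordinates in a base *)

Section Bases.

Variables (K : fieldType) (V W : vectType K) (n : nat).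
Implicit Types (b c : n.-tuple V) (d : n.-tuple W).

Lemma coord_fullv b v :
  basis_of {:V} b -> v = \sum_i coord b i v *: b`_i.
Proof. by move=> bP; apply: coord_basis bP (memvf v). Qed.

Lemma coord_linear (phi : {linear V -> W}) b d i v :
    basis_of {:V} b -> basis_of {:W} d -> (forall j : 'I_n, phi b`_j = d`_j) ->
  coord d i (phi v) = coord b i v.
Proof.
move=> bP dP phib; rewrite {1}(coord_fullv v bP) linear_sum.
under eq_bigr do rewrite linearZ phib.
exact: coord_sum_free (basis_free dP).
Qed.

Lemma linear_basis_exists b d :
    basis_of {:V} b ->
  exists phi : {linear V -> W}, forall i : 'I_n, phi b`_i = d`_i.
Proof.
move=> bP; have [phi phiP] := linear_of_free b d.
exists phi => i; rewrite -phiP ?(basis_free bP) ?size_tuple //.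
by rewrite (nth_map 0) ?size_tuple.
Qed.

Lemma basis_of_map_bij (phi : {linear V -> W}) (X : seq V) :
  bijective phi -> basis_of {:V} X -> basis_of {:W} (map phi X).
Proof.
case=> psi phiK psiK XP; pose F := linfun phi.
have FE : F =1 phi by apply: lfunE.
have injF : lker F == 0%VS.
  by apply/lker0P => x y; rewrite !FE; apply: can_inj phiK _ _.
have -> : map phi X = map F X by apply: eq_map => v; rewrite FE.
have -> : {:W}%VS = (F @: {:V})%VS.
  apply: subv_anti; rewrite subvf andbT; apply/subvP => w _.
  by rewrite -(psiK w) -FE memv_img ?memvf.
by apply: limg_basis_of XP; rewrite (eqP injF) capv0.
Qed.

Lemma morph_basis (mul : {bilinear V -> V -> V}) (mul' : {bilinear W -> W -> W})
    (phi : {linear V -> W}) b :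
    basis_of {:V} b ->
    (forall i j : 'I_n, phi (mul b`_i b`_j) = mul' (phi b`_i) (phi b`_j)) ->
  {morph phi : x y / mul x y >-> mul' x y}.
Proof.
move=> bP phiM x y.
rewrite (coord_fullv x bP) linear_sumlz !linear_sum linear_sumlz.
apply: eq_bigr => i _; rewrite linearZl_LR !linearZ linearZl_LR; congr (_ *: _).
rewrite (coord_fullv y bP) linear_sumr !linear_sum.
by apply: eq_bigr => j _; rewrite linearZr_LR !linearZ /= phiM.
Qed.

(** The change of base matrix: row i holds the coordinates of c_i in b. *)
Definition coord_mx b c : 'M[K]_n := \matrix_(i, j) coord b j c`_i.

Lemma coord_change b c v j :
  basis_of {:V} c -> coord b j v = \sum_i coord c i v * coord_mx b c i j.
Proof.
move=> cP; rewrite {1}(coord_fullv v cP) linear_sum.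
by apply: eq_bigr => i _; rewrite linearZ mxE.
Qed.

(** The inverse is the matrix of the reverse change of base. *)
Lemma coord_mx_unit b c :
  basis_of {:V} b -> basis_of {:V} c -> coord_mx b c \in unitmx.
Proof.
move=> bP cP; suff /mulmx1_unit[] : coord_mx c b *m coord_mx b c = 1%:M by [].
apply/matrixP => i j; rewrite !mxE -(coord_free _ _ (basis_free bP)).
by rewrite (coord_change b _ _ cP); apply: eq_bigr => k _; rewrite mxE.
Qed.

(** The vectors c_i whose coordinates are the rows of Y span the space because
the rows of the inverse of Y express b in terms of c; having the right number,
they form a base. *)
Lemma basis_of_coord_mx b (Y : 'M[K]_n) :
    basis_of {:V} b -> Y \in unitmx ->
  exists2 c : n.-tuple V, basis_of {:V} c & coord_mx b c = Y.
Proof.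
move=> bP Yunit; pose c := [tuple \sum_j Y i j *: b`_j | i < n].
have cE (i : 'I_n) : c`_i = \sum_j Y i j *: b`_j by rewrite -tnth_nth tnth_mktuple.
exists c; last first.
  by apply/matrixP => i j; rewrite mxE cE coord_sum_free ?(basis_free bP).
rewrite basisEdim (size_basis bP) size_tuple leqnn andbT -(span_basis bP).
apply/span_subvP => _ /(nthP 0)[k + <-]; rewrite size_tuple => ltkn.
pose k' := Ordinal ltkn; have -> : b`_k = \sum_i invmx Y k' i *: c`_i.
  under eq_bigr do rewrite cE scaler_sumr.
  rewrite exchange_big /=.
  under eq_bigr => j _.
    under eq_bigr do rewrite scalerA.
    rewrite -scaler_suml.
    have -> : \sum_i invmx Y k' i * Y i j = (k' == j)%:R.
      by have /matrixP/(_ k' j) := mulVmx Yunit; rewrite !mxE.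
    over.
  rewrite (bigD1 k') //= eqxx scale1r big1 ?addr0 // => j.
  by rewrite eq_sym => /negPf->; rewrite scale0r.
by apply: memv_suml => i _; rewrite memvZ // memv_span // mem_nth ?size_tuple.
Qed.

End Bases.

Lemma linear_id_basis (K : fieldType) (V : vectType K) n (b : n.-tuple V)
    (phi : {linear V -> V}) :
  basis_of {:V} b -> (forall i : 'I_n, phi b`_i = b`_i) -> phi =1 id.
Proof.
move=> bP phib v; rewrite [RHS](coord_fullv v bP).
rewrite [LHS](coord_fullv _ bP); apply: eq_bigr => i _.
by rewrite (coord_linear i v bP bP phib).
Qed.

Lemma linear_basis_bij (K : fieldType) (V W : vectType K) n
    (b : n.-tuple V) (d : n.-tuple W) :
    basis_of {:V} b -> basis_of {:W} d ->
  exists2 phi : {linear V -> W}, bijective phi & forall i : 'I_n, phi b`_i = d`_i.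
Proof.
move=> bP dP; have [phi phiE] := linear_basis_exists d bP.
have [psi psiE] := linear_basis_exists b dP.
exists phi => //; exists psi => v.
  apply: (linear_id_basis (phi := psi \o phi) bP) => i.
  by rewrite /= phiE psiE.
apply: (linear_id_basis (phi := phi \o psi) dP) => i.
by rewrite /= psiE phiE.
Qed.

(** * Isomorphism and structure matrices *)

Section Isomorphism.

Variables V V' : vectType 'F_2.
Variables (mul : {bilinear V -> V -> V}) (mul' : {bilinear V' -> V' -> V'}).

Lemma algebra_isomorphic_sym :
  algebra_isomorphic mul mul' -> algebra_isomorphic mul' mul.
Proof.
case=> phi [psi phiK psiK] phiM.
pose psiL := GRing.isLinear.Build _ _ _ _ psi (can2_linear phiK psiK).
pose psi' : {linear V' -> V} := HB.pack psi psiL.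
exists psi'; first by exists phi.
by move=> x y; apply: (can_inj phiK); rewrite phiM /= !psiK.
Qed.

Lemma structure_matrix_morph (phi : {linear V -> V'}) (e f : V) :
    {morph phi : x y / mul x y >-> mul' x y} ->
    basis_of {:V} [:: e; f] -> basis_of {:V'} [:: phi e; phi f] ->
  structure_matrix mul' (phi e) (phi f) = structure_matrix mul e f.
Proof.
move=> phiM efP efP'; apply/matrixP => i j; rewrite !mxE.
pose b := [tuple e; f]; pose d := [tuple phi e; phi f].
rewrite -(coord_linear (phi := phi) (b := b) (d := d)) //.
  by case: i => [[|[|[|[|]]]]] //= _; rewrite phiM.
by case=> [[|[|]]].
Qed.

End Isomorphism.

(** The structure matrix determines the algebra up to isomorphism, since it
records the products of base vectors and the product is bilinear. *)
Lemma algebra_isomorphicP (V V' : vectType 'F_2)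
    (mul : {bilinear V -> V -> V}) (mul' : {bilinear V' -> V' -> V'})
    (e' f' : V') :
    basis_of {:V'} [:: e'; f'] ->
  algebra_isomorphic mul mul' <->
  exists g h : V, basis_of {:V} [:: g; h]
    /\ structure_matrix mul g h = structure_matrix mul' e' f'.
Proof.
move=> efP'; split.
  case/algebra_isomorphic_sym => psi psi_bij psiM; exists (psi e'), (psi f').
  have psiP : basis_of {:V} [:: psi e'; psi f'].
    exact: basis_of_map_bij psi_bij efP'.
  by split=> //; apply: structure_matrix_morph.
case=> g [h [ghP eqS]]; pose b := [tuple g; h]; pose d := [tuple e'; f'].
have [phi phi_bij phiE] := linear_basis_bij (b := b) (d := d) ghP efP'.
exists phi => //.
have phig : phi g = e' := phiE 0.
have phih : phi h = f' := phiE 1.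
have phiS (i : 'I_4) : phi [:: mul g g; mul h h; mul g h; mul h g]`_i
    = [:: mul' e' e'; mul' f' f'; mul' e' f'; mul' f' e']`_i.
  rewrite [RHS](coord_fullv (b := d) _ efP').
  rewrite [LHS](coord_fullv (b := d) _ efP').
  apply: eq_bigr => j _; rewrite (coord_linear (phi := phi) (b := b)) //.
  by move/matrixP/(_ i j): eqS; rewrite !mxE => ->.
apply: (morph_basis (b := b) ghP).
(* Row-major enumeration gg, gh, hg, hh, whereas structure matrices list the
   squares first. *)
case=> [[|[|]]] // ? [[|[|]]] // ? /=; rewrite ?phig ?phih.
- exact: (phiS 0).
- exact: (phiS 2).
- exact: (phiS 3).
- exact: (phiS 1).
Qed.

(** * Change of base *)

Lemma F2_idem (a : 'F_2) : a * a = a.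
Proof. by case: a => [[|[|[]]]] // ?; apply: val_inj. Qed.

(** Where [tilde] comes from: over a general field the squares g^2 and h^2
would have squared coefficients on e^2 and f^2, and idempotency removes these
squares. *)
Lemma products_tilde (V : vectType 'F_2) (mul : {bilinear V -> V -> V})
    (e f : V) (Y : 'M['F_2]_2) (i : 'I_4) :
    let g := Y 0 0 *: e + Y 0 1 *: f in
    let h := Y 1 0 *: e + Y 1 1 *: f in
  [:: mul g g; mul h h; mul g h; mul h g]`_i =
    \sum_k tilde Y i k *: [:: mul e e; mul f f; mul e f; mul f e]`_k.
Proof.
move=> g h.
have mulE (a b c d : 'F_2) :
    mul (a *: e + b *: f) (c *: e + d *: f) =
      (a * c) *: mul e e + ((b * d) *: mul f f
        + ((a * d) *: mul e f + (b * c) *: mul f e)).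
  rewrite linearDl !linearDr !linearZl_LR !linearZr_LR !scalerA /=.
  by rewrite -addrA addrA [X in _ = _ + X]addrC !addrA.
rewrite !big_ord_recl big_ord0 /= addr0 !mxE /=.
by case: i => [[|[|[|[|]]]]] //= _; rewrite mulE ?F2_idem //;
  congr (_ *: _ + (_ *: _ + (_ *: _ + _ *: _))) => //; apply: mulrC.
Qed.

(** Right multiplication by Y converts coordinates in (g, h) into coordinates in
(e, f), where [products_tilde] can be read off. *)
Lemma structure_matrix_change (V : vectType 'F_2) (mul : {bilinear V -> V -> V})
    (e f g h : V) :
    let Y := coord_mx [tuple e; f] [tuple g; h] in
    basis_of {:V} [:: e; f] -> basis_of {:V} [:: g; h] ->
  structure_matrix mul g h *m Y = tilde Y *m structure_matrix mul e f.
Proof.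
move=> Y efP ghP; apply/matrixP => i j.
rewrite mxE; under eq_bigr do rewrite mxE.
rewrite -(coord_change (c := [tuple g; h]) _ _ _ ghP).
have ord1E : lift ord0 ord0 = 1 :> 'I_2 by apply: val_inj.
have gE : g = Y 0 0 *: e + Y 0 1 *: f.
  rewrite [LHS](coord_fullv (b := [tuple e; f]) _ efP) !big_ord_recl big_ord0.
  by rewrite addr0 ord1E !mxE.
have hE : h = Y 1 0 *: e + Y 1 1 *: f.
  rewrite [LHS](coord_fullv (b := [tuple e; f]) _ efP) !big_ord_recl big_ord0.
  by rewrite addr0 ord1E !mxE.
have := products_tilde mul e f Y i; rewrite -gE -hE => ->.
by rewrite linear_sum mxE; apply: eq_bigr => k _; rewrite linearZ !mxE.
Qed.

Theorem proposition1 (V V' : vectType 'F_2)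
    (mul : {bilinear V -> V -> V}) (mul' : {bilinear V' -> V' -> V'})
    (e f : V) (e' f' : V')
    (dimV : \dim {:V} = 2%N) (dimV' : \dim {:V'} = 2%N)
    (ef_basis : basis_of {:V} [:: e; f])
    (ef_basis' : basis_of {:V'} [:: e'; f']) :
  algebra_isomorphic mul mul' <->
  exists2 X : 'M['F_2]_2, X \in unitmx
    & structure_matrix mul' e' f'
      = tilde (invmx X) *m structure_matrix mul e f *m X.
Proof.
apply: (iff_trans (algebra_isomorphicP mul mul' ef_basis')).
pose b := [tuple e; f]; split=> [[g [h [ghP <-]]] | [X Xunit eqS]].
  have Yunit := coord_mx_unit (b := b) (c := [tuple g; h]) ef_basis ghP.
  exists (invmx (coord_mx b [tuple g; h])); first by rewrite unitmx_inv.
  by rewrite invmxK -structure_matrix_change // mulmxK.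
have Yunit : invmx X \in unitmx by rewrite unitmx_inv.
have [c] := basis_of_coord_mx (b := b) ef_basis Yunit.
case/tupleP: c => g c; case/tupleP: c => h c; rewrite (tuple0 c).
have -> : [tuple of g :: [tuple of h :: [tuple]]] = [tuple g; h].
  exact: val_inj.
move=> ghP YE; exists g, h; split=> //.
by rewrite eqS -YE -structure_matrix_change // YE mulmxKV.
Qed.
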